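(* Let $m=5^k$ with $k\in\mathbb{N}$, $k\geq1$. Then there exists an integer $a$ with $1\leq a<m$ and $\gcd(a,5)=1$ such that $K_{\mathbb{C}}(a/m)\leq 7$.
   Context: For $z\in\mathbb{C}$, $[z]:=\lfloor \mathrm{Re}(z)+\tfrac12\rfloor+i\lfloor \mathrm{Im}(z)+\tfrac12\rfloor$. Let $\mathfrak{F}=\{z\in\mathbb{C}: -\tfrac12\leq\mathrm{Re}(z)<\tfrac12,\ -\tfrac12\leq\mathrm{Im}(z)<\tfrac12\}$ and $T:\mathfrak{F}\to\mathfrak{F}$, $T(z)=z^{-1}-[z^{-1}]$ for $z\neq0$, $T(0)=0$. For $z\in\mathfrak{F}\setminus\{0\}$, $a_1(z)=[z^{-1}]$ and, while $T^{n-1}(z)\neq0$, $a_n(z)=a_1(T^{n-1}(z))$. For general $z\in\mathbb{C}$, $a_0(z)=[z]$ and $a_n(z)=a_n(z-a_0(z))$ for $n\geq1$. For $z\in\mathbb{Q}(i)$ the sequence terminates, giving the Hurwitz continued fraction $[a_0(z);a_1(z),\ldots,a_n(z)]_{\mathbb{C}}$, and $K_{\mathbb{C}}(z):=\max(|a_1(z)|,\ldots,|a_n(z)|)$ (the term $a_0$ is not included). *)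

(* Defs.v *)
From HB Require Import structures.
From mathcomp Require Import all_boot all_order all_algebra.
From mathcomp Require Import archimedean complex.
From mathcomp Require Import boolp reals ring lra.

Set Implicit Arguments.
Unset Strict Implicit.
Unset Printing Implicit Defensive.

Import Order.TTheory GRing.Theory Num.Theory.
Local Open Scope ring_scope.
Local Open Scope complex_scope.

Section Hurwitz.
Variable R : realType.
Implicit Types z w : R[i].

Definition nearest_gauss z : R[i] :=
  (Num.floor (complex.Re z + 2^-1))%:~R +i* (Num.floor (complex.Im z + 2^-1))%:~R.

Definition hurwitz_domain z : bool :=
  (- 2^-1 <= complex.Re z < 2^-1) && (- 2^-1 <= complex.Im z < 2^-1).

(* Only used on hurwitz_domain, which it maps to itself
   (hurwitz_map_domain below). *)
Definition hurwitz_map z : R[i] :=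
  if z == 0 then 0 else z^-1 - nearest_gauss z^-1.

Definition hurwitz_orbit z (n : nat) : R[i] :=
  iter n hurwitz_map (z - nearest_gauss z).

(* For n >= 1 this is the n-th partial quotient only as long as
   hurwitz_orbit z n.-1 != 0, i.e. for n <= hurwitz_length z when z is in Q(i);
   the value past that point (0) is junk. *)
Definition partial_quotient z (n : nat) : R[i] :=
  if n is n'.+1 then nearest_gauss (hurwitz_orbit z n')^-1
  else nearest_gauss z.

(* The index n of the last partial quotient of [a_0; a_1, ..., a_n], namely the
   least n with T^n (z - a_0) = 0.  It exists for every z in Q(i)
   (hurwitz_terminates below); the value 0 is junk if the expansion of z is
   infinite. *)
Definition hurwitz_length z : nat :=
  if pselect (exists n, hurwitz_orbit z n == 0) is left e then ex_minn e else 0.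

(* Moduli are nonnegative, so the neutral element 0 does not affect the maximum
   when hurwitz_length z >= 1. *)
Definition hurwitz_K z : R :=
  \big[Num.max/0]_(1 <= j < (hurwitz_length z).+1)
     complex.Re `|partial_quotient z j|.

Definition gauss_int z : bool :=
  (complex.Re z \is a Num.int) && (complex.Im z \is a Num.int).

Definition gauss_rat z : Prop :=
  exists p q : R[i], [/\ gauss_int p, gauss_int q, q != 0 & z = p / q].

Lemma sub_nearest_gauss_domain z : hurwitz_domain (z - nearest_gauss z).
Proof.
case: z => x y; rewrite /hurwitz_domain /nearest_gauss /=.
have := floor_itv (x + 2^-1); have := floor_itv (y + 2^-1).
rewrite !intrD; set a : R := _%:~R; set b : R := _%:~R.
by move=> /andP[? ?] /andP[? ?]; apply/andP; split; apply/andP; split; lra.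
Qed.

Lemma hurwitz_map_domain z : hurwitz_domain (hurwitz_map z).
Proof.
rewrite /hurwitz_map; case: eqP => _; last exact: sub_nearest_gauss_domain.
by rewrite /hurwitz_domain /= ; apply/andP; split; apply/andP; split; lra.
Qed.

Lemma hurwitz_orbit_domain z n : hurwitz_domain (hurwitz_orbit z n).
Proof.
by case: n => [|n]; [exact: sub_nearest_gauss_domain|exact: hurwitz_map_domain].
Qed.

Let nsq z : R := complex.Re z ^+ 2 + complex.Im z ^+ 2.

Let nsqM z w : nsq (z * w) = nsq z * nsq w.
Proof. by case: z w => a b [c d]; rewrite /nsq /=; ring. Qed.

Let nsq_domain z : hurwitz_domain z -> nsq z <= 2^-1.
Proof.
case: z => x y; rewrite /hurwitz_domain /nsq /=.
by move=> /andP[/andP[? ?] /andP[? ?]]; nra.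
Qed.

Let nsq_gt0 z : z != 0 -> 0 < nsq z.
Proof.
move=> z0; rewrite lt_neqAle addr_ge0 ?sqr_ge0// andbT eq_sym.
apply: contra z0; case: z => x y; rewrite /nsq /=.
rewrite paddr_eq0 ?sqr_ge0// !sqrf_eq0 => /andP[/eqP-> /eqP->].
by apply/eqP.
Qed.

Let gauss_intB z w : gauss_int z -> gauss_int w -> gauss_int (z - w).
Proof.
case: z w => a b [c d]; rewrite /gauss_int /=.
by move=> /andP[? ?] /andP[? ?]; rewrite !rpredB.
Qed.

Let gauss_intM z w : gauss_int z -> gauss_int w -> gauss_int (z * w).
Proof.
case: z w => a b [c d]; rewrite /gauss_int /=.
by move=> /andP[? ?] /andP[? ?]; rewrite rpredB ?rpredD ?rpredM.
Qed.

Let nearest_gauss_int z : gauss_int (nearest_gauss z).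
Proof. by rewrite /gauss_int /= !intr_int. Qed.

Let nsq_int z : gauss_int z -> nsq z \is a Num.int.
Proof. by move=> /andP[? ?]; rewrite rpredD ?rpredX. Qed.

Lemma hurwitz_terminates z :
  gauss_rat z -> exists n, hurwitz_orbit z n == 0.
Proof.
move=> [p [q [Gp Gq q0 ->]]]; rewrite /hurwitz_orbit.
set w := _ - _; have Dw : hurwitz_domain w by exact: sub_nearest_gauss_domain.
have {Gp} [p' Gp' Ew] : exists2 p', gauss_int p' & w = p' / q.
  exists (p - nearest_gauss (p / q) * q).
    by rewrite gauss_intB ?gauss_intM ?nearest_gauss_int.
  by rewrite mulrBl mulfK.
have [N] : exists N : nat, nsq q < N%:R.
  by exists (Num.bound (nsq q)); apply: archi_boundP; exact/ltW/nsq_gt0.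
clearbody w => {p}; elim: N => [|N IH] in p' q Gp' Gq q0 w Dw Ew *.
  by rewrite ltNge (ltW (nsq_gt0 q0)).
move=> ltqN; have [->|w0] := eqVneq w 0; first by exists 0%N.
have p0 : p' != 0 by apply: contra_neq w0; rewrite Ew => ->; rewrite mul0r.
have ltpq : nsq p' < nsq q.
  have -> : nsq p' = nsq w * nsq q by rewrite -nsqM Ew divfK.
  by have := nsq_domain Dw; have := nsq_gt0 q0; nra.
have ltpN : nsq p' < N%:R.
  move: (nsq_int Gp') (nsq_int Gq) ltpq ltqN => /intrP[m ->] /intrP[l ->].
  rewrite !pmulrn !ltr_int -addn1 PoszD ltzD1; exact: lt_le_trans.
have [||n Hn] := IH (q - nearest_gauss w^-1 * p') p' _ Gp' p0 (hurwitz_map w)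
  (hurwitz_map_domain w) _ ltpN.
- by rewrite gauss_intB ?gauss_intM ?nearest_gauss_int.
- by rewrite /hurwitz_map (negbTE w0) mulrBl mulfK// {1}Ew invf_div.
- by exists n.+1; rewrite iterSr.
Qed.

End Hurwitz.

(* Main.v *)
Require Import Defs.
From mathcomp Require Import all_boot all_order all_algebra.
From mathcomp Require Import archimedean complex reals.
From mathcomp Require Import zify ring lra.
Import Order.TTheory GRing.Theory Num.Theory.
Local Open Scope ring_scope.

(** On real numbers the Hurwitz algorithm is the nearest-integer algorithm.
    If a regular continued fraction [0; b_1, b_2, ...] has all b_i <= N, then up
    to sign every point of its nearest-integer orbit is 0 or 1 / (c + y), where
    2 <= c <= N + 1 and y again has regular partial quotients at most N: a
    remainder y = 1 / (1 + y') >= 1/2 is replaced by y - 1 = - 1 / (1 + 1 / y').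
    Hence the nearest-integer partial quotients are at most N + 2.

    It remains to find regular expansions with denominator 5^k, partial
    quotients at most 4, and first and last ones f, e in {2, 3}. This is
    Niederreiter's folding argument: if f, l, e has denominator q, then
    f, l, e+1, e-1, rev l, f has denominator q^2, and
    f, l, e, 4, 1, e-1, rev l, f has denominator 5 q^2. Starting from
    2/5 = [0; 2, 2], this reaches every exponent. *)

Section Folding.
Local Open Scope nat_scope.

(** The product of the matrices [[b, 1], [1, 0]], b in [l], applied to the column [u]. *)
Definition cf_act (l : seq nat) (u : nat * nat) : nat * nat :=
  foldr (fun b v => (b * v.1 + v.2, v.1)) u l.

(* [0; l] = (cf_frac l).2 / (cf_frac l).1 *)
Definition cf_frac (l : seq nat) : nat * nat := cf_act l (1, 0).

Definition dot (u v : nat * nat) : nat := u.1 * v.1 + u.2 * v.2.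

Lemma cf_act_cat l1 l2 u : cf_act (l1 ++ l2) u = cf_act l1 (cf_act l2 u).
Proof. by rewrite /cf_act foldr_cat. Qed.

(* The matrices [[b, 1], [1, 0]] are symmetric. *)
Lemma dot_cf_act_rev l u v : dot (cf_act (rev l) u) v = dot u (cf_act l v).
Proof.
elim: l u => [|b l IH] u //.
rewrite rev_cons -cats1 cf_act_cat IH /dot /=; ring.
Qed.

Lemma dot10 v : dot (1, 0) v = v.1.
Proof. by rewrite /dot /= mul1n mul0n addn0. Qed.

Lemma cf_den_rcons l e (w := cf_act (rev l) (1, 0)) :
  (cf_frac (rcons l e)).1 = w.1 * e + w.2.
Proof.
rewrite /cf_frac -cats1 cf_act_cat -dot10 -dot_cf_act_rev -/w /dot /=; ring.
Qed.

(** By symmetry the denominator is the quadratic form of the middle block at the vector w of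
    [cf_den_rcons], here the square of (e+1) w_1 + w_2. *)
Lemma cf_den_fold_sqr l e :
  (cf_frac (l ++ [:: e.+2; e] ++ rev l)).1 = (cf_frac (rcons l e.+1)).1 ^ 2.
Proof.
rewrite cf_den_rcons /cf_frac !cf_act_cat -dot10 -dot_cf_act_rev /dot /=; ring.
Qed.

Lemma cf_den_fold_mul_sqr l e x :
  (cf_frac (l ++ [:: e.+1; x; 1; e] ++ rev l)).1
  = x.+1 * (cf_frac (rcons l e.+1)).1 ^ 2.
Proof.
rewrite cf_den_rcons /cf_frac !cf_act_cat -dot10 -dot_cf_act_rev /dot /=; ring.
Qed.

Lemma coprime_cf_frac l : coprime (cf_frac l).1 (cf_frac l).2.
Proof.
elim: l => [|b l IH] //=; rewrite -/(cf_act l _) -/(cf_frac l).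
by rewrite coprime_sym /coprime gcdnMDl.
Qed.

Lemma cf_den_gt0 N l : all (fun b => 0 < b <= N) l -> 0 < (cf_frac l).1.
Proof. by elim: l => [|b l IH] //= /andP[? /IH]; rewrite /cf_frac; nia. Qed.

(** Folding trades the last quotient e for some of e - 1, e, e + 1 (and 4, 1), so ends in {2, 3}
    keep all quotients within 1, ..., 4. Both new ends equal f. *)
Lemma pow5_cf_den k : 0 < k -> exists l f e,
  [/\ 1 < f < 4, 1 < e < 4, all (fun b => 0 < b <= 4) l
    & (cf_frac (f :: rcons l e)).1 = 5 ^ k].
Proof.
elim/ltn_ind: k => k IH k0.
have [->|k1] := eqVneq k 1; first by exists [::], 2, 2.
(* From here on the old last quotient is [e.+1]. *)
have [| |l [f [[|e] [hf he hl El]]]] // := IH k./2; [lia|lia|].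
have foldE s : f :: rcons (l ++ s ++ rev l) f = (f :: l) ++ s ++ rev (f :: l).
  by rewrite rev_cons -!rcons_cat.
have [ok|ek] := boolP (odd k).
- exists (l ++ [:: e.+1; 4; 1; e] ++ rev l), f, f; split=> //.
    by rewrite !all_cat all_rev hl /=; lia.
  rewrite foldE cf_den_fold_mul_sqr rcons_cons El -expnM -expnS.
  by congr (_ ^ _); lia.
- exists (l ++ [:: e.+2; e] ++ rev l), f, f; split=> //.
    by rewrite !all_cat all_rev hl /=; lia.
  by rewrite foldE cf_den_fold_sqr rcons_cons El -expnM; congr (_ ^ _); lia.
Qed.

End Folding.

Section NearestInteger.
Variables (R : realType) (N : nat).
Implicit Types (x y z : R) (m n : int).

Inductive regular_cf : R -> Prop :=
| regular_cf0 : regular_cf 0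
| regular_cfS (b : nat) y : (0 < b <= N)%N -> regular_cf y ->
    regular_cf (b%:R + y)^-1.

Definition nearest_cf z : Prop :=
  z = 0 \/ exists (c : nat) y,
    [/\ (1 < c <= N.+1)%N, regular_cf y & `|z| = (c%:R + y)^-1].

Lemma nearest_cfN z : nearest_cf z -> nearest_cf (- z).
Proof.
case=> [->|[c [y [? ? E]]]]; first by left; rewrite oppr0.
by right; exists c, y; rewrite normrN.
Qed.

Lemma regular_cf_itv y : regular_cf y -> 0 <= y <= 1.
Proof.
elim=> [|b {}y /andP[b0 _] _ /andP[y0 y1]]; first by rewrite lexx ler01.
have b1 : 1 <= b%:R :> R by rewrite ler1n.
by rewrite invr_ge0 addr_ge0 ?ler0n //= invf_le1; lra.
Qed.

Lemma regular_nearest_cf y : regular_cf y -> y <= 2^-1 -> nearest_cf y.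
Proof.
case=> [|b {}y hb hy]; first by left.
have /andP[y0 y1] := regular_cf_itv y hy.
have b1 : 1 <= b%:R :> R by rewrite ler1n; lia.
move=> le2; have {}le2 : 2 <= b%:R + y by rewrite -lef_pV2 ?posrE; lra.
right; have [b2|b2] := leqP 2 b.
  by exists b, y; split=> //; [lia|rewrite ger0_norm // invr_ge0; lra].
(* Then y = 1 and the value is 1/2, rewritten with c = 2 and remainder 0. *)
have Eb : b = 1%N by lia.
exists 2%N, 0; split; [lia|exact: regular_cf0|].
rewrite {}Eb in b1 le2 *; have -> : y = 1 by lra.
by rewrite natr1 addr0 ger0_norm ?invr_ge0 ?ler0n.
Qed.

Lemma regular_nearest_cf_sub1 y :
  regular_cf y -> 2^-1 <= y -> nearest_cf (1 - y).
Proof.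
case=> [|b {}y hb hy]; first by lra.
have /andP[y0 y1] := regular_cf_itv y hy.
have b1 : 1 <= b%:R :> R by rewrite ler1n; lia.
move=> le2; have {}le2 : b%:R + y <= 2 by rewrite -lef_pV2 ?posrE; lra.
have [b2|b2] := leqP 2 b.
  have b2R : 2 <= b%:R :> R by rewrite ler_nat.
  have -> : b%:R + y = 2 by lra.
  right; exists 2%N, 0; split; [lia|exact: regular_cf0|].
  by rewrite addr0 ger0_norm; lra.
have -> : b = 1%N by lia.
case: hy y0 y1 {le2} => [|b' y' hb' hy'] _ _.
  by left; rewrite addr0 invr1 subrr.
have /andP[y0 y1] := regular_cf_itv y' hy'.
have b1' : 1 <= b'%:R :> R by rewrite ler1n; lia.
(* Here c = b' + 1 can reach N + 1. *)
right; exists b'.+1, y'; split=> //.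
have -> : 1 - (1 + (b'%:R + y')^-1)^-1 = (b'.+1%:R + y')^-1.
  by rewrite -natr1; field; apply/andP; split; lra.
by rewrite ger0_norm // invr_ge0 -natr1; lra.
Qed.

Lemma regular_cf_round y n : regular_cf y -> `|y - n%:~R| <= 2^-1 ->
  `|n%:~R : R| <= 1 /\ nearest_cf (y - n%:~R).
Proof.
move=> hy; have /andP[y0 y1] := regular_cf_itv y hy.
rewrite ler_norml => /andP[h1 h2].
have n1 : -1 < n by rewrite -(ltr_int R) mulrNz; lra.
have n2 : n < 2 by rewrite -(ltr_int R); lra.
have [En|En] : n = 0 \/ n = 1 by lia.
  rewrite En in h1 h2 *; rewrite normr0 subr0 in h1 h2 *; split=> //.
  by apply: regular_nearest_cf => //.
rewrite En in h1 h2 *; rewrite normr1; split=> //.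
by rewrite -opprB; apply/nearest_cfN/regular_nearest_cf_sub1 => //; lra.
Qed.

(** Allowing every m within 1/2 makes the claim symmetric under z -> -z, whereas floor rounding is
    not odd at ties. For z > 0, m is c plus the rounding of y, which is 0 or 1. *)
Lemma nearest_cf_round z m : nearest_cf z -> `|z^-1 - m%:~R| <= 2^-1 ->
  `|m%:~R : R| <= N.+2%:R /\ nearest_cf (z^-1 - m%:~R).
Proof.
wlog z0 : z m / 0 <= z => [hw|].
  have [|z0] := leP 0 z; first exact: hw.
  move=> /nearest_cfN hz; have E : z^-1 - m%:~R = - ((- z)^-1 - (- m)%:~R).
    by rewrite invrN mulrNz; ring.
  have z0' : 0 <= - z by lra.
  rewrite E normrN => /(hw _ _ z0' hz)[].
  by rewrite mulrNz normrN => ? /nearest_cfN.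
case=> [->|[c [y [hc hy]]]].
  (* As [0^-1 = 0], a vanishing remainder gives m = 0. *)
  rewrite invr0 sub0r normrN => hm; split; last first.
    left; suff -> : m = 0 by rewrite oppr0.
    have : `|m| < 1 by rewrite -(ltr_int R) intr_norm; lra.
    by lia.
  have N1 : 1 <= N.+2%:R :> R by rewrite ler1n.
  by apply: (le_trans hm); apply: le_trans N1; lra.
rewrite ger0_norm // => ->; rewrite invrK.
have -> : c%:R + y - m%:~R = y - (m - c%:Z)%:~R.
  by rewrite intrB -pmulrn; ring.
move=> /(regular_cf_round _ _ hy)[hm ?]; split=> //.
move: hm; rewrite intrB -pmulrn => hm.
have hcN : c%:R <= N.+1%:R :> R by rewrite ler_nat; lia.
rewrite -(subrK c%:R m%:~R); apply: le_trans (ler_normD _ _) _.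
by rewrite normr_nat -natr1; lra.
Qed.

End NearestInteger.

Section RealHurwitz.
Variables (R : realType).
Local Open Scope complex_scope.
Implicit Types x : R.

Definition nearest_int x : int := Num.floor (x + 2^-1).

Lemma nearest_intP x : `|x - (nearest_int x)%:~R| <= 2^-1.
Proof.
have := floor_itv (x + 2^-1); rewrite intrD ler_norml -/(nearest_int x).
by move=> /andP[? ?]; apply/andP; split; lra.
Qed.

Lemma nearest_gauss_real x : nearest_gauss x%:C = (nearest_int x)%:~R%:C.
Proof.
rewrite /nearest_gauss /= add0r; congr (_ +i* _).
suff -> : Num.floor (2^-1 : R) = 0 by [].
by apply: floor_def; rewrite add0r /=; apply/andP; split; lra.
Qed.

Lemma hurwitz_K_regular_cf N x :
  regular_cf R N x -> hurwitz_K x%:C <= N.+2%:R.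
Proof.
move=> hx.
(* The orbit stays real, and [nearest_cf] is its invariant. *)
have orbit n : exists2 z, nearest_cf R N z & hurwitz_orbit x%:C n = z%:C.
  elim: n => [|n [z hz Ez]].
    exists (x - (nearest_int x)%:~R).
      by have [] := regular_cf_round _ _ _ _ hx (nearest_intP x).
    by rewrite /hurwitz_orbit /= nearest_gauss_real rmorphB.
  rewrite /hurwitz_orbit iterS -/(hurwitz_orbit _ n) Ez /hurwitz_map.
  case: eqP => _; first by exists 0 => //; left.
  exists (z^-1 - (nearest_int z^-1)%:~R).
    by have [] := nearest_cf_round _ _ _ _ hz (nearest_intP z^-1).
  by rewrite -fmorphV nearest_gauss_real rmorphB.
rewrite /hurwitz_K big_nat; apply: bigmax_le => [|[|j] // _].
  exact: ler0n.
rewrite /partial_quotient; have [z hz ->] := orbit j.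
rewrite -fmorphV nearest_gauss_real normc_def /= expr0n addr0 sqrtr_sqr.
by have [] := nearest_cf_round _ _ _ _ hz (nearest_intP z^-1).
Qed.

Lemma regular_cf_frac N l : all (fun b => 0 < b <= N)%N l ->
  regular_cf R N ((cf_frac l).2%:R / (cf_frac l).1%:R).
Proof.
elim: l => [|b l IH] /=; first by rewrite mul0r => _; exact: regular_cf0.
move=> /andP[hb hl]; have u0 := cf_den_gt0 _ _ hl.
have := regular_cfS _ _ _ _ hb (IH hl).
rewrite -/(cf_act l _) -/(cf_frac l) natrD natrM.
move: (cf_frac l) u0 => [u v] /= u0.
have u0R : u%:R != 0 :> R by rewrite pnatr_eq0 -lt0n.
by rewrite -[_ / (_ + v%:R)]invf_div mulrDl mulfK.
Qed.

End RealHurwitz.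

Theorem theorem5p7 (R : realType) (k : nat) (hk : (1 <= k)%N) :
  exists a : nat,
    [/\ (1 <= a < 5 ^ k)%N, gcdn a 5 = 1%N &
        hurwitz_K (a%:R / (5 ^ k)%N%:R : R[i]) <= 7%:R].
Proof.
have [l [f [e [hf he hl E]]]] := pow5_cf_den k hk.
have hl' : all (fun b => 0 < b <= 4)%N (rcons l e).
  by rewrite all_rcons hl; lia.
exists (cf_frac (f :: rcons l e)).2; split.
(* The numerator is the denominator u > 0 of the tail, and u < f u + v because f >= 2. *)
- rewrite -E /=; have := cf_den_gt0 _ _ hl'; rewrite /cf_frac; nia.
- have := coprime_cf_frac (f :: rcons l e).
  by rewrite E coprime_sym coprime_pexpr // => /eqP.
- have hall : all (fun b => 0 < b <= 4)%N (f :: rcons l e).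
    by rewrite /= hl'; lia.
  have := hurwitz_K_regular_cf _ _ _ (regular_cf_frac R _ _ hall).
  rewrite E rmorphM fmorphV !rmorph_nat => /le_trans; apply.
  (* The bound obtained is N + 2 = 6 for N = 4. *)
  by rewrite ler_nat.
Qed.
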